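(* Let $n\in\mathbb{N}$, $n\ge1$. The singular twisted virtual braid monoid $STVB_n$ embeds in the singular twisted virtual group $STVG_n$; that is, the canonical monoid homomorphism $STVB_n\to STVG_n$ sending each generator $\sigma_i^{\pm1},\rho_i,\tau_i,\gamma_j$ to the generator of the same name is injective.
   Context: The singular twisted virtual braid monoid $STVB_n$ is the monoid with identity $e$, generators $\sigma_i,\sigma_i^{-1},\rho_i,\tau_i$ ($1\le i\le n-1$) and $\gamma_i$ ($1\le i\le n$), and the following defining relations (for all indices for which they make sense): (1) $\sigma_i\sigma_i^{-1}=\sigma_i^{-1}\sigma_i=e$, $\rho_i^2=e$, $\gamma_i^2=e$; (2) for $|i-j|>1$: $\sigma_i\sigma_j=\sigma_j\sigma_i$, $\rho_i\rho_j=\rho_j\rho_i$, $\sigma_i\rho_j=\rho_j\sigma_i$, $\tau_i\tau_j=\tau_j\tau_i$, $\sigma_i\tau_j=\tau_j\sigma_i$, $\tau_i\rho_j=\rho_j\tau_i$; (3) for $1\le i\le n-2$: $\sigma_i\sigma_{i+1}\sigma_i=\sigma_{i+1}\sigma_i\sigma_{i+1}$, $\rho_i\rho_{i+1}\rho_i=\rho_{i+1}\rho_i\rho_{i+1}$, $\rho_i\sigma_{i+1}\rho_i=\rho_{i+1}\sigma_i\rho_{i+1}$, $\rho_i\tau_{i+1}\rho_i=\rho_{i+1}\tau_i\rho_{i+1}$, $\sigma_i\sigma_{i+1}\tau_i=\tau_{i+1}\sigma_i\sigma_{i+1}$, $\sigma_{i+1}\sigma_i\tau_{i+1}=\tau_i\sigma_{i+1}\sigma_i$;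 (4) $\sigma_i\tau_i=\tau_i\sigma_i$ for $1\le i\le n-1$; (5) $\gamma_i\gamma_j=\gamma_j\gamma_i$ for $1\le i,j\le n$; and for $j\ne i,i+1$: $\gamma_j\rho_i=\rho_i\gamma_j$, $\gamma_j\sigma_i=\sigma_i\gamma_j$, $\gamma_j\tau_i=\tau_i\gamma_j$; (6) for $1\le i\le n-1$: $\gamma_{i+1}\rho_i=\rho_i\gamma_i$, $\rho_i\sigma_i\rho_i=\gamma_{i+1}\gamma_i\sigma_i\gamma_i\gamma_{i+1}$, $\rho_i\tau_i\rho_i=\gamma_{i+1}\gamma_i\tau_i\gamma_i\gamma_{i+1}$. The singular twisted virtual group $STVG_n$ is the group generated by the generators of $STVB_n$ together with $\bar\tau_i$ ($1\le i\le n-1$), subject to: all relations of $STVB_n$ above; $\bar\tau_i\tau_i=e$; for $|i-j|>1$: $\bar\tau_i\rho_j=\rho_j\bar\tau_i$, $\bar\tau_i\bar\tau_j=\bar\tau_j\bar\tau_i$, $\bar\tau_i\tau_j=\tau_j\bar\tau_i$; $\bar\tau_i\gamma_j=\gamma_j\bar\tau_i$ for $j\ne i,i+1$; $\sigma_i\bar\tau_i=\bar\tau_i\sigma_i$; $\rho_i\bar\tau_{i+1}\rho_i=\rho_{i+1}\bar\tau_i\rho_{i+1}$; $\sigma_i\sigma_{i+1}\bar\tau_i=\bar\tau_{i+1}\sigma_i\sigma_{i+1}$; $\sigma_{i+1}\sigma_i\bar\tau_{i+1}=\bar\tau_i\sigma_{i+1}\sigma_i$; $\rho_i\bar\tau_i\rho_i=\gamma_{i+1}\gamma_i\bar\tau_i\gamma_i\gamma_{i+1}$.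 (Since $STVG_n$ is a group, $\bar\tau_i=\tau_i^{-1}$, and $STVG_n$ is equivalently the group presented by the generators and relations of $STVB_n$.) *)

(* Defs.v *)
From HB Require Import structures.
From mathcomp Require Import all_boot.
From mathcomp Require Import boolp.

Set Implicit Arguments.
Unset Strict Implicit.
Unset Printing Implicit Defensive.

Local Open Scope group_scope.
Local Open Scope quotient_scope.

Section PresentedMonoid.
Variables (X : choiceType) (R : seq X -> seq X -> Prop).

Inductive cong : seq X -> seq X -> Prop :=
| cong_rel u v : R u v -> cong u v
| cong_refl u : cong u u
| cong_sym u v : cong u v -> cong v u
| cong_trans v u w : cong u v -> cong v w -> cong u w
| cong_cat u u' v v' : cong u u' -> cong v v' -> cong (u ++ v) (u' ++ v').

Definition congb : rel (seq X) := fun u v => `[< cong u v >].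

Lemma congb_refl : reflexive congb.
Proof. by move=> u; apply/asboolP; apply: cong_refl. Qed.

Lemma congb_sym : symmetric congb.
Proof. by move=> u v; apply/asboolP/asboolP; apply: cong_sym. Qed.

Lemma congb_trans : transitive congb.
Proof.
by move=> v u w /asboolP uv /asboolP vw; apply/asboolP; apply: cong_trans uv vw.
Qed.

Canonical congb_equiv := EquivRel congb congb_refl congb_sym congb_trans.

Definition pres_monoid := {eq_quot congb}.

HB.instance Definition _ := Choice.on pres_monoid.
HB.instance Definition _ := Quotient.on pres_monoid.

Definition pm_class (u : seq X) : pres_monoid := \pi u.

Lemma pm_classP u v : pm_class u = pm_class v <-> cong u v.
Proof.
split=> [/eqmodP /asboolP // | uv].
by apply/eqmodP; apply/asboolP.
Qed.

Lemma pm_classK (a : pres_monoid) : pm_class (repr a) = a.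
Proof. exact: reprK. Qed.

Lemma cong_repr u : cong (repr (pm_class u)) u.
Proof. by apply/pm_classP; rewrite pm_classK. Qed.

Definition pm_mul (a b : pres_monoid) := pm_class (repr a ++ repr b).
Definition pm_one := pm_class [::].

Lemma pm_mulE u v : pm_mul (pm_class u) (pm_class v) = pm_class (u ++ v).
Proof. by apply/pm_classP/cong_cat; apply: cong_repr. Qed.

Lemma pm_mulA : associative pm_mul.
Proof.
move=> a b c; rewrite -[a]pm_classK -[b]pm_classK -[c]pm_classK.
by rewrite !pm_mulE catA.
Qed.

Lemma pm_mul1 : left_id pm_one pm_mul.
Proof. by move=> a; rewrite -[a]pm_classK pm_mulE. Qed.

Lemma pm_mul1r : right_id pm_one pm_mul.
Proof. by move=> a; rewrite -[a]pm_classK pm_mulE cats0. Qed.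

HB.instance Definition _ := isMonoid.Build pres_monoid pm_mulA pm_mul1 pm_mul1r.

Definition pm_gen (x : X) : pres_monoid := pm_class [:: x].

Lemma pm_class_prod u : pm_class u = \prod_(x <- u) pm_gen x.
Proof.
elim: u => [|x u IHu]; first by rewrite big_nil.
by rewrite big_cons -IHu -[LHS]/(pm_class ([:: x] ++ u)) -pm_mulE.
Qed.

Section Lift.
Variables (M : monoidType) (f : X -> M).
Hypothesis fR : forall u v, R u v -> \prod_(x <- u) f x = \prod_(x <- v) f x.

Lemma cong_prod u v : cong u v -> \prod_(x <- u) f x = \prod_(x <- v) f x.
Proof.
elim=> {u v} [u v /fR //|//|u v _ -> //|v u w _ -> _ -> //|].
by move=> u u' v v' _ Eu _ Ev; rewrite !big_cat /= Eu Ev.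
Qed.

(* The homomorphism given by the universal property of the presentation;     *)
(* the phantom argument [fR] is what makes it well defined on classes.       *)
Definition pm_lift of (forall u v, R u v ->
    \prod_(x <- u) f x = \prod_(x <- v) f x) :=
  fun a : pres_monoid => \prod_(x <- repr a) f x.

Lemma pm_lift_class u : pm_lift fR (pm_class u) = \prod_(x <- u) f x.
Proof. exact/cong_prod/cong_repr. Qed.

Lemma pm_lift_gen x : pm_lift fR (pm_gen x) = f x.
Proof. by rewrite pm_lift_class big_seq1. Qed.

Lemma pm_lift_monoid_morphism : monoid_morphism (pm_lift fR).
Proof.
split=> [|a b]; first by rewrite -[1]/(pm_class [::]) pm_lift_class big_nil.
rewrite -[a]pm_classK -[b]pm_classK -[_ * _]/(pm_mul _ _) pm_mulE.
by rewrite !pm_lift_class big_cat.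
Qed.

HB.instance Definition _ :=
  isUMagmaMorphism.Build pres_monoid M (pm_lift fR) pm_lift_monoid_morphism.

End Lift.

End PresentedMonoid.

(* Group presentations: words on X + X, where [inl x] is the generator x and *)
(* [inr x] its formal inverse.                                               *)
Section PresentedGroup.
Variables (X : choiceType) (R : seq X -> seq X -> Prop).

Inductive group_rel : seq (X + X) -> seq (X + X) -> Prop :=
| group_rel_rel u v : R u v -> group_rel (map inl u) (map inl v)
| group_rel_mulgV x : group_rel [:: inl x; inr x] [::]
| group_rel_mulVg x : group_rel [:: inr x; inl x] [::].

Definition pres_group := pres_monoid group_rel.

HB.instance Definition _ := Monoid.on pres_group.

Definition formal_inv (x : X + X) : X + X :=
  match x with inl y => inr y | inr y => inl y end.

Definition word_inv (u : seq (X + X)) := rev (map formal_inv u).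

Definition pg_inv (a : pres_group) : pres_group :=
  pm_class group_rel (word_inv (repr a)).

Lemma cong_word_mulV u : cong group_rel (word_inv u ++ u) [::].
Proof.
elim: u => [|x u IHu]; first exact: cong_refl.
rewrite /word_inv map_cons rev_cons cat_rcons -/(word_inv u).
apply: (cong_trans _ IHu); apply: (cong_cat (cong_refl _ _)).
rewrite -[u in cong _ _ u]cat0s -[_ :: _]/([:: formal_inv x; x] ++ u).
apply: cong_cat; last exact: cong_refl.
by apply: cong_rel; case: x => x /=; constructor.
Qed.

Lemma word_invK : involutive word_inv.
Proof.
by move=> u; rewrite /word_inv map_rev revK -map_comp map_id_in // => -[].
Qed.

Lemma pg_mulVg : left_inverse 1 pg_inv (@mul pres_group).
Proof.
move=> a; rewrite -{2}[a]pm_classK -[_ * _]/(pm_mul _ _) pm_mulE.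
exact/pm_classP/cong_word_mulV.
Qed.

Lemma pg_mulgV : right_inverse 1 pg_inv (@mul pres_group).
Proof.
move=> a; rewrite -{1}[a]pm_classK -[_ * _]/(pm_mul _ _) pm_mulE.
by apply/pm_classP; rewrite -{1}[repr a]word_invK; apply: cong_word_mulV.
Qed.

HB.instance Definition _ := hasInv.Build pres_group pg_inv.
HB.instance Definition _ := Monoid_isGroup.Build pres_group pg_mulVg pg_mulgV.

Definition pg_gen (x : X) : pres_group := pm_gen group_rel (inl x).

Lemma pg_prod_rel u v :
  R u v -> \prod_(x <- u) pg_gen x = \prod_(x <- v) pg_gen x.
Proof.
have prodE w : \prod_(x <- w) pg_gen x = pm_class group_rel (map inl w).
  by rewrite pm_class_prod big_map.
by move=> uv; rewrite !prodE; apply/pm_classP/cong_rel/group_rel_rel.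
Qed.

End PresentedGroup.

(* Indices are 0-based: sigma_i, rho_i, tau_i are indexed by 'I_n.-1 and     *)
(* gamma_i by 'I_n.                                                          *)
Inductive STVB_gen (n : nat) :=
| sigma of 'I_n.-1 | sigmaV of 'I_n.-1 | rho of 'I_n.-1 | tau of 'I_n.-1
| gamma of 'I_n.

Definition STVB_gen_code n (x : STVB_gen n) :
    'I_n.-1 + 'I_n.-1 + ('I_n.-1 + 'I_n.-1) + 'I_n :=
  match x with
  | sigma i => inl (inl (inl i)) | sigmaV i => inl (inl (inr i))
  | rho i => inl (inr (inl i)) | tau i => inl (inr (inr i))
  | gamma j => inr j
  end.

Definition STVB_gen_decode n
    (c : 'I_n.-1 + 'I_n.-1 + ('I_n.-1 + 'I_n.-1) + 'I_n) : STVB_gen n :=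
  match c with
  | inl (inl (inl i)) => sigma i | inl (inl (inr i)) => sigmaV i
  | inl (inr (inl i)) => rho i | inl (inr (inr i)) => tau i
  | inr j => gamma j
  end.

Lemma STVB_gen_codeK n : cancel (@STVB_gen_code n) (@STVB_gen_decode n).
Proof. by case. Qed.

HB.instance Definition _ n :=
  Finite.copy (STVB_gen n) (can_type (@STVB_gen_codeK n)).

Definition far (i j : nat) := (i.+1 < j) || (j.+1 < i).

(* In the relations involving both i and i+1, the index i+1 is a separate    *)
(* ordinal constrained by an equation in nat.                                *)
Inductive STVB_rel n : seq (STVB_gen n) -> seq (STVB_gen n) -> Prop :=
| sig_sigV i : STVB_rel [:: sigma i; sigmaV i] [::]
| sigV_sig i : STVB_rel [:: sigmaV i; sigma i] [::]
| rho2 i : STVB_rel [:: rho i; rho i] [::]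
| gam2 j : STVB_rel [:: gamma j; gamma j] [::]

| sig_sig_far (i j : 'I_n.-1) : far i j ->
    STVB_rel [:: sigma i; sigma j] [:: sigma j; sigma i]
| rho_rho_far (i j : 'I_n.-1) : far i j ->
    STVB_rel [:: rho i; rho j] [:: rho j; rho i]
| sig_rho_far (i j : 'I_n.-1) : far i j ->
    STVB_rel [:: sigma i; rho j] [:: rho j; sigma i]
| tau_tau_far (i j : 'I_n.-1) : far i j ->
    STVB_rel [:: tau i; tau j] [:: tau j; tau i]
| sig_tau_far (i j : 'I_n.-1) : far i j ->
    STVB_rel [:: sigma i; tau j] [:: tau j; sigma i]
| tau_rho_far (i j : 'I_n.-1) : far i j ->
    STVB_rel [:: tau i; rho j] [:: rho j; tau i]

| sig_sig_sig (i i1 : 'I_n.-1) : i1 = i.+1 :> nat ->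
    STVB_rel [:: sigma i; sigma i1; sigma i] [:: sigma i1; sigma i; sigma i1]
| rho_rho_rho (i i1 : 'I_n.-1) : i1 = i.+1 :> nat ->
    STVB_rel [:: rho i; rho i1; rho i] [:: rho i1; rho i; rho i1]
| rho_sig_rho (i i1 : 'I_n.-1) : i1 = i.+1 :> nat ->
    STVB_rel [:: rho i; sigma i1; rho i] [:: rho i1; sigma i; rho i1]
| rho_tau_rho (i i1 : 'I_n.-1) : i1 = i.+1 :> nat ->
    STVB_rel [:: rho i; tau i1; rho i] [:: rho i1; tau i; rho i1]
| sig_sig1_tau (i i1 : 'I_n.-1) : i1 = i.+1 :> nat ->
    STVB_rel [:: sigma i; sigma i1; tau i] [:: tau i1; sigma i; sigma i1]
| sig1_sig_tau1 (i i1 : 'I_n.-1) : i1 = i.+1 :> nat ->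
    STVB_rel [:: sigma i1; sigma i; tau i1] [:: tau i; sigma i1; sigma i]

| sig_tau i : STVB_rel [:: sigma i; tau i] [:: tau i; sigma i]

| gam_gam i j : STVB_rel [:: gamma i; gamma j] [:: gamma j; gamma i]
| gam_rho (i : 'I_n.-1) (j : 'I_n) : j <> i :> nat -> j <> i.+1 :> nat ->
    STVB_rel [:: gamma j; rho i] [:: rho i; gamma j]
| gam_sig (i : 'I_n.-1) (j : 'I_n) : j <> i :> nat -> j <> i.+1 :> nat ->
    STVB_rel [:: gamma j; sigma i] [:: sigma i; gamma j]
| gam_tau (i : 'I_n.-1) (j : 'I_n) : j <> i :> nat -> j <> i.+1 :> nat ->
    STVB_rel [:: gamma j; tau i] [:: tau i; gamma j]

| gam1_rho (i : 'I_n.-1) (j j1 : 'I_n) : j = i :> nat -> j1 = i.+1 :> nat ->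
    STVB_rel [:: gamma j1; rho i] [:: rho i; gamma j]
| rho_sig_gam (i : 'I_n.-1) (j j1 : 'I_n) : j = i :> nat -> j1 = i.+1 :> nat ->
    STVB_rel [:: rho i; sigma i; rho i]
             [:: gamma j1; gamma j; sigma i; gamma j; gamma j1]
| rho_tau_gam (i : 'I_n.-1) (j j1 : 'I_n) : j = i :> nat -> j1 = i.+1 :> nat ->
    STVB_rel [:: rho i; tau i; rho i]
             [:: gamma j1; gamma j; tau i; gamma j; gamma j1].

Definition STVB n : monoidType := pres_monoid (@STVB_rel n).

(* The second summand holds the additional generators \bar\tau_i. *)
Definition STVG_gen n : choiceType := (STVB_gen n + 'I_n.-1)%type.

Definition old n (x : STVB_gen n) : STVG_gen n := inl x.
Definition tauB n (i : 'I_n.-1) : STVG_gen n := inr i.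

Notation osig i := (old (sigma i)).
Notation orho i := (old (rho i)).
Notation otau i := (old (tau i)).
Notation ogam i := (old (gamma i)).

Inductive STVG_rel n : seq (STVG_gen n) -> seq (STVG_gen n) -> Prop :=
| old_rel u v : STVB_rel u v ->
    STVG_rel (map (@old n) u) (map (@old n) v)
| tauB_tau i : STVG_rel [:: tauB i; otau i] [::]

| tauB_rho_far (i j : 'I_n.-1) : far i j ->
    STVG_rel [:: tauB i; orho j] [:: orho j; tauB i]
| tauB_tauB_far (i j : 'I_n.-1) : far i j ->
    STVG_rel [:: tauB i; tauB j] [:: tauB j; tauB i]
| tauB_tau_far (i j : 'I_n.-1) : far i j ->
    STVG_rel [:: tauB i; otau j] [:: otau j; tauB i]
| tauB_gam (i : 'I_n.-1) (j : 'I_n) : j <> i :> nat -> j <> i.+1 :> nat ->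
    STVG_rel [:: tauB i; ogam j] [:: ogam j; tauB i]

| sig_tauB i : STVG_rel [:: osig i; tauB i] [:: tauB i; osig i]

| rho_tauB_rho (i i1 : 'I_n.-1) : i1 = i.+1 :> nat ->
    STVG_rel [:: orho i; tauB i1; orho i] [:: orho i1; tauB i; orho i1]
| sig_sig1_tauB (i i1 : 'I_n.-1) : i1 = i.+1 :> nat ->
    STVG_rel [:: osig i; osig i1; tauB i] [:: tauB i1; osig i; osig i1]
| sig1_sig_tauB1 (i i1 : 'I_n.-1) : i1 = i.+1 :> nat ->
    STVG_rel [:: osig i1; osig i; tauB i1] [:: tauB i; osig i1; osig i]

| rho_tauB_gam (i : 'I_n.-1) (j j1 : 'I_n) :
    j = i :> nat -> j1 = i.+1 :> nat ->
    STVG_rel [:: orho i; tauB i; orho i]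
             [:: ogam j1; ogam j; tauB i; ogam j; ogam j1].

Definition STVG n : groupType := pres_group (@STVG_rel n).

Lemma STVB_rel_STVG n (u v : seq (STVB_gen n)) : STVB_rel u v ->
  \prod_(x <- u) (pg_gen (@STVG_rel n) (old x) : STVG n)
  = \prod_(x <- v) (pg_gen (@STVG_rel n) (old x) : STVG n).
Proof.
by move=> uv; have := pg_prod_rel (old_rel uv); rewrite !big_map.
Qed.

Definition STVB_to_STVG n : UMagmaMorphism.type (STVB n) (STVG n) :=
  pm_lift (@STVB_rel_STVG n).

Lemma STVB_to_STVG_gen n (x : STVB_gen n) :
  STVB_to_STVG n (pm_gen (@STVB_rel n) x) = pg_gen (@STVG_rel n) (old x).
Proof. exact: pm_lift_gen. Qed.

(* Main.v *)
Require Import Defs.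
From mathcomp Require Import all_boot all_algebra.
From mathcomp Require Import zify.

(* Every relation of STVB_n involving tau either says that a unit conjugates one
   tau_i to another, or that tau_i and tau_j commute. Hence STVB_n is the
   semidirect product of its group of tau-free elements with a partially
   commutative monoid on the conjugates of the tau_i, and a product of conjugates
   is determined by its projections onto the pairs {a, b} of noncommuting (or
   equal) elements. Each such pair yields an action of STVG_n on STVB_n * Z^2: a
   tau-free generator multiplies the first component g on the left, while tau_i
   applies one elementary shear of Z^2 if g a g^-1 = tau_i, and the other one if
   g b g^-1 = tau_i. The two shears generate a free monoid, so the orbit of
   (1, (1, 1)) recovers the tau-free part and the projection to {a, b}. *)

Set Implicit Arguments.
Unset Strict Implicit.
Unset Printing Implicit Defensive.

Local Open Scope group_scope.

(** * Words determined up to commutation by their projections to pairs *)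

Section Projections.
Variable M : monoidType.
Implicit Types (a b x : M) (s t : seq M).

(** Equal letters are included so that the projections also count the occurrences of each letter. *)
Definition separable a b := (a == b) || (a * b != b * a).

Lemma separable_sym a b : separable a b = separable b a.
Proof. by rewrite /separable eq_sym [_ * _ == _]eq_sym. Qed.

Lemma prod_commute x s :
  {in s, forall z, x * z = z * x} -> x * \prod_(z <- s) z = (\prod_(z <- s) z) * x.
Proof.
elim: s => [|z s IHs] xs; first by rewrite big_nil mulg1 mul1g.
rewrite big_cons mulgA xs ?mem_head // -!mulgA IHs // => w ws.
by apply: xs; rewrite inE ws orbT.
Qed.

(** Let [x] be the head of [s]. A letter [z] before the first [x] in [t] cannot be separable from
    [x], since the projections to [x] and [z] would then start differently. So [x] commutes to the
    front of [t], and induction applies to the remainders. *)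
Lemma eq_prod_projections s t :
  (forall a b, separable a b -> filter (pred2 a b) s = filter (pred2 a b) t) ->
  \prod_(x <- s) x = \prod_(x <- t) x.
Proof.
elim: s t => [|x s IHs] t st.
  case: t st => [//|z t] /(_ z z); rewrite /separable eqxx /= eqxx.
  by move=> /(_ isT).
have xt : x \in t.
  have := st x x; rewrite /separable eqxx /= eqxx => /(_ isT) xE.
  have: x \in filter (pred2 x x) t by rewrite -xE mem_head.
  by rewrite mem_filter => /andP[].
have [t1 [t2 [tE xt1]]] : exists t1 t2, t = t1 ++ x :: t2 /\ x \notin t1.
  exists (take (index x t) t), (drop (index x t).+1 t); split.
    rewrite -{1}[t](cat_take_drop (index x t)) (drop_nth x) ?index_mem //.
    by rewrite nth_index.
  by rewrite in_take_leq ?index_size // ltnn.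
have sep_t1 z : z \in t1 -> ~~ separable x z.
  move=> zt1; apply/negP => /st; rewrite tE /= eqxx /= filter_cat.
  case fE: (filter _ t1) => [|y r].
    have: z \in filter (pred2 x z) t1 by rewrite mem_filter /= eqxx orbT.
    by rewrite fE.
  have: y \in filter (pred2 x z) t1 by rewrite fE mem_head.
  rewrite mem_filter => /andP[_ yt1] [yE _].
  by rewrite yE yt1 in xt1.
have xC z : z \in t1 -> x * z = z * x.
  by move=> /sep_t1; rewrite negb_or negbK => /andP[_ /eqP].
rewrite tE big_cat !big_cons /= mulgA -(prod_commute xC) -mulgA -big_cat.
congr (_ * _); apply: IHs => a b ab.
have := st a b ab; rewrite tE !filter_cat /=; case: ifP => // xab.
(* A letter of [t1] in the pair would differ from [x], so the pair would be that letter and [x],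
   which are not separable. *)
suff -> : filter (pred2 a b) t1 = [::] by case.
rewrite (eq_in_filter (a2 := pred0)) ?filter_pred0 // => z zt1 /=.
have zx : z != x by apply: contraNneq xt1 => <-.
apply/negP => zab; have := sep_t1 z zt1; apply/negP; rewrite negbK.
case/orP: xab zab zx ab => /eqP -> /orP[] /eqP ->; rewrite ?eqxx //.
by rewrite separable_sym.
Qed.

End Projections.

(** * Elementary shears of Z^2 *)

Section Shears.
Local Open Scope ring_scope.

Definition shear (c s : bool) (y : int * int) : int * int :=
  let d k : int := if s then k else - k in
  if c then (y.1 + d y.2, y.2) else (y.1, y.2 + d y.1).

Lemma shearK c s : cancel (shear c s) (shear c (~~ s)).
Proof. by case: c s => -[] [y1 y2]; rewrite /shear /=; congr pair; lia. Qed.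

Lemma shear_inj c s : injective (shear c s).
Proof. exact: can_inj (shearK c s). Qed.

Lemma shear_pos c y : (0 < y.1) && (0 < y.2) ->
  (0 < (shear c true y).1) && (0 < (shear c true y).2).
Proof. by case: c y => -[y1 y2] /=; lia. Qed.

End Shears.

(** * Reading a projection off a vector of Z^2 *)

Section Decoding.
Variable M : monoidType.
Implicit Types (a b m : M) (s t : seq M) (y : int * int).

(* With m = t * e, the tests compare e a e^-1 and e b e^-1 with t without
   requiring e to be invertible. *)
Definition tau_step a b (e m : M) (s : bool) y :=
  if (a == b) || (e * a * b != e * b * a) then
    if e * a == m then shear true s y
    else if e * b == m then shear false s y else y
  else y.

Lemma tau_stepK a b e m (s : bool) :
  cancel (tau_step a b e m s) (tau_step a b e m (~~ s)).
Proof.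
move=> y; rewrite /tau_step; case: (_ || _) => //.
by case: (e * a == m); [|case: (e * b == m)]; rewrite ?shearK.
Qed.

Lemma tau_step_cancel (h a b e m : M) (s : bool) y : injective (fun x => h * x) ->
  tau_step a b (h * e) (h * m) s y = tau_step a b e m s y.
Proof. by move=> h_inj; rewrite /tau_step -!mulgA !(inj_eq h_inj). Qed.

(** If the steps used different shears, then e a = t e and e b = t' e with t, t' commuting, so e a b
    = t t' e = e b a. The guard leaves only a = b, where the first test already succeeds for both.
    So two nontrivial steps use shears of the same kind, which commute. *)
Lemma tau_step_comm (a b e m1 m2 t1 t2 : M) (s1 s2 : bool) y :
  m1 = t1 * e -> m2 = t2 * e -> t1 * t2 = t2 * t1 ->
  tau_step a b e m1 s1 (tau_step a b e m2 s2 y)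
  = tau_step a b e m2 s2 (tau_step a b e m1 s1 y).
Proof.
move=> -> -> tC; rewrite /tau_step.
case: (boolP ((a == b) || (e * a * b != e * b * a))) => // ab.
have clash (t t' : M) : t * t' = t' * t -> e * a = t * e -> e * b = t' * e ->
    e * a = t' * e.
  move=> tt' ea eb; case/orP: ab => [/eqP -> //|/eqP[]].
  by rewrite ea eb -!mulgA ea eb !mulgA tt'.
have shearC c : shear c s1 (shear c s2 y) = shear c s2 (shear c s1 y).
  by rewrite /shear; case: c s1 s2 => -[] [] /=; congr pair; lia.
case: (e * a =P t1 * e) => a1; case: (e * a =P t2 * e) => a2 //;
  case: (e * b =P t1 * e) => b1; case: (e * b =P t2 * e) => b2 //.
- by case: a2; apply: clash a1 b2.
- by case: a2; apply: clash a1 b2.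
- by case: a1; apply: clash a2 b1.
- by case: a1; apply: clash a2 b1.
Qed.

(** The start (1, 1) is positive with equal coordinates, whereas a positive shear of a positive
    vector has unequal ones; this tells the empty projection apart. *)
Definition decode a b s : int * int :=
  foldr (fun x => tau_step a b 1 x true) (1, 1)%R s.

Lemma decode_filter a b s : decode a b s = decode a b (filter (pred2 a b) s).
Proof.
elim: s => //= x s IHs; case: ifP => /= xab; rewrite /= IHs //.
rewrite /tau_step !mul1g ![_ == x]eq_sym; case: ifP => // _.
by move: xab; case: eqP => //=; case: eqP.
Qed.

Lemma decode_pos a b s : (0 < (decode a b s).1)%R && (0 < (decode a b s).2)%R.
Proof.
elim: s => //= x s IHs; rewrite /tau_step; case: ifP => // _.
by case: ifP => _; [| case: ifP => // _]; apply: shear_pos.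
Qed.

(* After shear [true] the first coordinate is the larger one, after shear
   [false] the second one is, so the last letter can be read off. *)
Lemma decode_inj a b s t : separable a b -> decode a b s = decode a b t ->
  filter (pred2 a b) s = filter (pred2 a b) t.
Proof.
move=> ab; rewrite (decode_filter _ _ s) (decode_filter _ _ t).
have: all (pred2 a b) (filter (pred2 a b) s) by apply: filter_all.
have: all (pred2 a b) (filter (pred2 a b) t) by apply: filter_all.
move: (filter _ s) (filter _ t) => {}s {}t.
have stepE x y : pred2 a b x -> tau_step a b 1 x true y = shear (x == a) true y.
  rewrite /tau_step !mul1g -/(separable a b) ab ![_ == x]eq_sym /=.
  by case: eqP => // _ /= ->.
elim: s t => [|x s IHs] [|z t] //=.
- by move=> /andP[zab _] _; rewrite stepE //; have := decode_pos a b t;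
    case: (decode a b t) => y1 y2; case: (z == a) => /=; rewrite /shear /=;
    move=> yP [] *; lia.
- by move=> _ /andP[xab _]; rewrite stepE //; have := decode_pos a b s;
    case: (decode a b s) => y1 y2; case: (x == a) => /=; rewrite /shear /=;
    move=> yP [] *; lia.
move=> /andP[zab ta] /andP[xab sa]; rewrite !stepE //.
(* Both letters lie in the pair, so if the tests agree then [x] is [z] and the common shear
   cancels. *)
case: (altP (x == a =P (z == a))) => [xz | xz].
  rewrite xz => /shear_inj /(IHs _ ta sa) ->; congr cons.
  case/orP: xab zab xz => /eqP -> /orP[] /eqP -> //; rewrite eqxx.
    by move/esym/eqP.
  by move/eqP.
have := decode_pos a b s; have := decode_pos a b t.
case: (decode a b s) => y1 y2; case: (decode a b t) => z1 z2.
by case: (x == a) (z == a) xz => -[] //= _; rewrite /shear /=;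
  move=> zP yP [] *; lia.
Qed.

End Decoding.

(** * The action of the group and the normal form *)

Section Embedding.
Variable n : nat.
Implicit Types (z : STVB_gen n) (w : seq (STVB_gen n * bool)).
Let M : monoidType := STVB n.
Let gen z : M := pm_gen (@STVB_rel n) z.
Let class (u : seq (STVB_gen n)) : M := pm_class (@STVB_rel n) u.

Definition is_tau z := if z is tau _ then true else false.
Definition detau u := filter (predC is_tau) u.

Let classE u : class u = \prod_(x <- u) gen x.
Proof. exact: pm_class_prod. Qed.

Let class_cons z u : class (z :: u) = gen z * class u.
Proof. by rewrite !classE big_cons. Qed.

Let class_rel u v : STVB_rel u v -> class u = class v.
Proof. by move=> uv; apply/pm_classP/cong_rel. Qed.

Lemma detau_cons z u :
  class (detau (z :: u)) = (if is_tau z then 1 else gen z) * class (detau u).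
Proof.
by rewrite /=; case: (is_tau z); rewrite /= ?mul1g ?class_cons.
Qed.

Lemma unit_gen z : ~~ is_tau z -> exists h : M, h * gen z = 1 /\ gen z * h = 1.
Proof.
have rel2 x y : STVB_rel [:: x; y] [::] -> gen x * gen y = 1.
  by move=> /class_rel; rewrite !classE !big_cons big_nil mulg1.
case: z => // i _; [exists (gen (sigmaV i)) | exists (gen (sigma i))
  | exists (gen (rho i)) | exists (gen (gamma i))]; by split; apply: rel2; constructor.
Qed.

Lemma detau_unit u : exists h : M, h * class (detau u) = 1 /\ class (detau u) * h = 1.
Proof.
elim: u => [|z u [h [hu uh]]]; first by exists 1; rewrite !mulg1.
rewrite detau_cons; case: ifP => [_|/negbT/unit_gen[k [kz zk]]].
  by exists h; rewrite mul1g.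
exists (h * k); split; first by rewrite -mulgA [k * _]mulgA kz mul1g.
by rewrite mulgA -[_ * _ * h]mulgA uh mulg1.
Qed.

Definition act a b (x : STVB_gen n * bool) (p : M * (int * int)) :=
  if is_tau x.1 then (p.1, tau_step a b p.1 (gen x.1 * p.1) x.2 p.2)
  else (gen x.1 * p.1, p.2).

Definition acts a b w p := foldr (act a b) p w.

(** If w = u tau_i v, the only step compares v p.1 with tau_i v p.1. As u is a unit, multiplying
    both by u on the left changes no test, so only the classes of u v and w matter. *)
Lemma acts_short a b w s p :
  (count (is_tau \o fst) w <= 1)%N ->
  all (fun x => is_tau x.1 ==> (x.2 == s)) w ->
  acts a b w p =
  (class (detau (map fst w)) * p.1,
   if has (is_tau \o fst) w
   then tau_step a b (class (detau (map fst w)) * p.1)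
                     (class (map fst w) * p.1) s p.2
   else p.2).
Proof.
elim: w => [|[z t] w IHw]; first by rewrite /= mul1g; case: p.
rewrite [count _ _]/= [all _ _]/= [map _ _]/= detau_cons class_cons /=.
move=> cw /andP[ts /IHw{}IHw]; rewrite /act /=.
have cw' : (count (is_tau \o fst) w <= 1)%N by lia.
rewrite IHw //=; case: ifP => zt /=; last first.
  congr pair; first by rewrite mulgA.
  have [h [hz _]] := unit_gen (negbT zt).
  rewrite -!mulgA tau_step_cancel // => x y.
  by move/(congr1 (fun k : M => h * k)); rewrite !mulgA hz !mul1g.
have w0 : ~~ has (is_tau \o fst) w by rewrite has_count; lia.
have -> : detau (map fst w) = map fst w.
  apply/all_filterP; rewrite all_map; apply/allP => x xw /=.
  by apply: contra w0 => ?; apply/hasP; exists x.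
by rewrite (negPf w0) mul1g mulgA; move: ts; rewrite zt => /eqP ->.
Qed.

Lemma acts_rel s u v a b p : class (map fst u) = class (map fst v) ->
    class (detau (map fst u)) = class (detau (map fst v)) ->
    (count (is_tau \o fst) u <= 1)%N ->
    count (is_tau \o fst) u = count (is_tau \o fst) v ->
    all (fun x => is_tau x.1 ==> (x.2 == s)) (u ++ v) ->
  acts a b u p = acts a b v p.
Proof.
move=> uv duv cu cuv; rewrite all_cat => /andP[au av].
by rewrite (@acts_short a b u s) // (@acts_short a b v s) -?cuv // uv duv !has_count cuv.
Qed.

Lemma acts_tau_far (i j : 'I_n.-1) s t a b p : far i j ->
  acts a b [:: (tau i, s); (tau j, t)] p = acts a b [:: (tau j, t); (tau i, s)] p.
Proof.
move=> /tau_tau_far/class_rel; rewrite !class_cons !mulg1 => tC.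
by rewrite /act /=; congr pair; apply: tau_step_comm tC.
Qed.

Let rho_rho (i : 'I_n.-1) : class [:: rho i; rho i] = 1.
Proof. by apply: class_rel; constructor. Qed.

Let gamma_gamma_gamma_gamma (j j1 : 'I_n) :
  class [:: gamma j1; gamma j; gamma j; gamma j1] = 1.
Proof.
have gg k : gen (gamma k) * gen (gamma k) = 1.
  have := class_rel (gam2 k); rewrite !class_cons !mulg1; exact.
by rewrite !class_cons mulg1 [gen (gamma j) * _]mulgA gg mul1g gg.
Qed.

Lemma acts_STVB_rel u v a b p : STVB_rel u v ->
  acts a b [seq (z, true) | z <- u] p = acts a b [seq (z, true) | z <- v] p.
Proof.
move=> uv; have cuv := class_rel uv.
have mapK t : map fst [seq (z, true) | z <- t] = t :> seq (STVB_gen n).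
  by rewrite -map_comp map_id.
(* What remains is the relation between two far tau letters, and the two relations whose tau-free
   parts are distinct words for 1. *)
case: uv cuv => *; try by apply: (@acts_rel true); rewrite ?mapK.
- exact: acts_tau_far.
- by apply: (@acts_rel true); rewrite ?mapK // !rho_rho.
- by apply: (@acts_rel true); rewrite ?mapK // rho_rho gamma_gamma_gamma_gamma.
Qed.

(* Inverses of non-tau generators are replaced by equivalent generators, so only
   the sign of a tau letter is meaningful. *)
Definition signed_gen (x : STVG_gen n + STVG_gen n) : STVB_gen n * bool :=
  match x with
  | inl (inl z) => (z, true)
  | inl (inr i) => (tau i, false)
  | inr (inl (sigma i)) => (sigmaV i, true)
  | inr (inl (sigmaV i)) => (sigma i, true)
  | inr (inl (tau i)) => (tau i, false)
  | inr (inl z) => (z, true)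
  | inr (inr i) => (tau i, true)
  end.

(** As [tauB i] acts by [tau i] with the sign reversed, its relations with a single tau letter on
    each side follow from those of [tau], with sign [false]. *)
Lemma acts_STVG_rel u v a b p : STVG_rel u v ->
  acts a b [seq signed_gen (inl x) | x <- u] p
  = acts a b [seq signed_gen (inl x) | x <- v] p.
Proof.
case=> {u v} [u v uv|i|i j ij|i j ij|i j ij|i j ji ji1|i|i i1 E|i i1 E|i i1 E
  |i j j1 E E1].
- by rewrite -!map_comp; apply: acts_STVB_rel.
- by case: p => g y; congr pair; exact: (tau_stepK _ _ _ _ true).
- apply: (@acts_rel false) => //=; exact/class_rel/tau_rho_far.
- exact: acts_tau_far.
- exact: acts_tau_far.
- apply: (@acts_rel false) => //=; exact/esym/class_rel/gam_tau.
- apply: (@acts_rel false) => //=; exact/class_rel/sig_tau.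
- apply: (@acts_rel false) => //=; first exact/class_rel/rho_tau_rho.
  by rewrite !rho_rho.
- apply: (@acts_rel false) => //=; exact/class_rel/sig_sig1_tau.
- apply: (@acts_rel false) => //=; exact/class_rel/sig1_sig_tau1.
- apply: (@acts_rel false) => //=; first exact/class_rel/rho_tau_gam.
  by rewrite rho_rho gamma_gamma_gamma_gamma.
Qed.

Lemma acts_cong u v a b p : cong (group_rel (@STVG_rel n)) u v ->
  acts a b (map signed_gen u) p = acts a b (map signed_gen v) p.
Proof.
move=> uv; elim: uv p => {u v}
  [u v uv|//|u v _ IH|u v w _ IHu _ IHv|u u' v v' _ IHu _ IHv] p.
- have cancel2 x y : STVB_rel [:: x; y] [::] ->
      acts a b [:: (x, true); (y, true)] p = p.
    exact: (@acts_STVB_rel _ _ a b p).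
  case: uv => {u v} [u v uv|x|x]; first by rewrite -!map_comp; apply: acts_STVG_rel.
    case: x => [[]|] i; try by apply: cancel2; constructor.
      by case: p {cancel2} => g y; congr pair; exact: (tau_stepK _ _ _ _ false).
    by case: p {cancel2} => g y; congr pair; exact: (tau_stepK _ _ _ _ true).
  case: x => [[]|] i; try by apply: cancel2; constructor.
    by case: p {cancel2} => g y; congr pair; exact: (tau_stepK _ _ _ _ true).
  by case: p {cancel2} => g y; congr pair; exact: (tau_stepK _ _ _ _ false).
- by rewrite IH.
- by rewrite IHu IHv.
- by move: (IHv p); rewrite !map_cat /acts !foldr_cat => ->; apply: IHu.
Qed.

(** With g the tau-free part, tau_i g = g (g^-1 tau_i g), so a tau letter prepends a conjugate to
    [s] and any other letter only changes g. The step at g tests g a = tau_i g; cancelling g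
    compares a with that conjugate, as [decode] does. *)
Lemma semidirect_normal_form u : exists s : seq M,
  class u = class (detau u) * \prod_(x <- s) x /\
  forall a b, acts a b [seq (z, true) | z <- u] (1, (1, 1)%R)
    = (class (detau u), decode a b s).
Proof.
elim: u => [|z u [s [us IHs]]]; first by exists [::]; rewrite big_nil mulg1.
rewrite detau_cons class_cons; have [h [hu uh]] := detau_unit u.
case: ifP => zt.
  exists (h * gen z * class (detau u) :: s); split=> [|a b].
    by rewrite mul1g us big_cons !mulgA uh mul1g.
  rewrite /= IHs /act /= zt /= mul1g; congr pair.
  have -> : gen z * class (detau u)
      = class (detau u) * (h * gen z * class (detau u)).
    by rewrite !mulgA uh mul1g.
  rewrite -{1}[class (detau u)]mulg1 tau_step_cancel // => x y.
  by move/(congr1 (fun k : M => h * k)); rewrite !mulgA hu !mul1g.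
by exists s; split=> [|a b]; rewrite ?us ?mulgA //= IHs /act /= zt.
Qed.

End Embedding.

Theorem theorem4p2 (n : nat) (hn : (1 <= n)%N) :
  injective (STVB_to_STVG n).
Proof.
move=> c d; rewrite -[c]pm_classK -[d]pm_classK.
move: (repr c) (repr d) => {c d} u v.
have prodE (t : seq (STVB_gen n)) :
    STVB_to_STVG n (pm_class (@STVB_rel n) t)
    = pm_class (group_rel (@STVG_rel n)) [seq inl (old z) | z <- t].
  by rewrite [LHS]pm_lift_class pm_class_prod big_map.
rewrite !prodE => /pm_classP uv.
have [s [-> us]] := semidirect_normal_form u.
have [t [-> vt]] := semidirect_normal_form v.
(* Words equal in the group move (1, (1, 1)) to the same point. *)
have eq_st a b : (pm_class (@STVB_rel n) (detau u), decode a b s)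
    = (pm_class (@STVB_rel n) (detau v), decode a b t).
  rewrite -us -vt; have := acts_cong a b (1, (1, 1)%R) uv.
  by rewrite -!map_comp.
(* The tau-free part is the same for every pair, so the pair 1, 1 is an arbitrary choice. *)
have [-> _] := eq_st 1 1; congr (_ * _).
apply: eq_prod_projections => a b ab; apply: decode_inj => //.
by have [_ ->] := eq_st a b.
Qed.
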